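(* Let $\Phi$ be a finite crystallographic root system and let $X\subseteq\Phi$ be a summable set with no vanishing subsum. Then for every integer $1\le p\le |X|$, $X$ has at least $p$ distinct summable subsets of size $|X|-p+1$.
   Context: Let $V$ be a real Euclidean space with scalar product $\langle\cdot,\cdot\rangle$. For $\alpha\neq0$ let $\alpha^\vee=2\alpha/\langle\alpha,\alpha\rangle$ and $s_\alpha(v)=v-\langle\alpha^\vee,v\rangle\alpha$. A finite root system is a finite set $\Phi\subset V\setminus\{0\}$ with $\Phi\cap\mathbb{R}\alpha=\{\alpha,-\alpha\}$ and $s_\alpha\Phi=\Phi$ for all $\alpha\in\Phi$; it is crystallographic if $\langle\alpha^\vee,\beta\rangle\in\mathbb{Z}$ for all $\alpha,\beta\in\Phi$. A set $X\subseteq\Phi$ is summable if the sum of its elements is a root of $\Phi$, and has no vanishing subsum if the sum of every nonempty subset of $X$ is nonzero. *)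

(* Defs.v *)
From HB Require Import structures.
From mathcomp Require Import all_boot all_order all_algebra.
From mathcomp Require Import finmap reals.

Set Implicit Arguments.
Unset Strict Implicit.
Unset Printing Implicit Defensive.

Import GRing.Theory Num.Theory.

Local Open Scope ring_scope.
Local Open Scope fset_scope.

Section RootSystem.
(* A Euclidean space is a finite-dimensional real vector space V together with
   a symmetric positive definite bilinear form ip; with the trivial
   involution [idfun], [{dot V for idfun}] is the type of such forms. *)
Variables (R : realType) (V : vectType R) (ip : {dot V for idfun}).
Implicit Types (a b v : V) (Phi X : {fset V}).

Definition coroot a : V := (2 / ip a a) *: a.

Definition reflection a v : V := v - ip (coroot a) v *: a.

Definition root_system Phi : Prop :=
  [/\ 0 \notin Phi,
      forall a, a \in Phi ->
        forall b, (b \in Phi /\ exists c : R, b = c *: a) <-> (b = a \/ b = - a)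
    & forall a, a \in Phi -> [fset reflection a b | b in Phi] = Phi].

Definition crystallographic Phi : Prop :=
  forall a b, a \in Phi -> b \in Phi -> ip (coroot a) b \is a Num.int.

End RootSystem.

Section Summable.
Variable V : nmodType.
Implicit Types (Phi X : {fset V}).

Definition summable Phi X : bool := \sum_(x <- X) x \in Phi.

Definition no_vanishing_subsum X : Prop :=
  forall Y : {fset V}, Y `<=` X -> Y != fset0 -> \sum_(x <- Y) x != 0.

End Summable.

(* Main.v *)
(* If [b] is the sum of a family of at least two roots without vanishing subsum,
   then for every member [x] some other member [y] can be removed, that is,
   [b - y] is again a root.  Otherwise [<b, y> <= 0] for all [y] other than [x].
   If some [z] has [<x, z> < 0], then [x + z] is a root, and induction applies to
   the family in which [x] and [z] are replaced by [x + z].  Otherwise the sum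
   [c = b - x] of the other members satisfies [<b, c> <= 0 <= <x, c>], so
   [<c, c> <= 0] and [c] is a vanishing subsum.
   Consequently every [x] in [X] lies in summable subsets of [X] of all sizes.
   If [X] minus [x] is summable, its summable subsets of size [k], together with
   one that contains [x], give the count by induction. *)

Require Import Defs.
From HB Require Import structures.
From mathcomp Require Import all_boot all_order all_algebra.
From mathcomp Require Import finmap reals.

Set Implicit Arguments.
Unset Strict Implicit.
Unset Printing Implicit Defensive.

Import Order.TTheory GRing.Theory Num.Theory.

Local Open Scope ring_scope.
Local Open Scope fset_scope.

Section Roots.
Local Open Scope ring_scope.
Variables (R : realType) (V : vectType R) (ip : {dot V for idfun}).
Implicit Types (a b x y : V) (s t u : seq V).

Lemma ipC a b : ip a b = ip b a.
Proof. by rewrite hermC expr0 mul1r. Qed.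

Lemma ip_le0 a : ip a a <= 0 -> a = 0.
Proof.
by apply: contraTeq => a_neq0; rewrite -ltNge neq0_dnorm_gt0.
Qed.

Lemma ip_coroot a b : ip (coroot ip a) b = 2 / ip a a * ip a b.
Proof. by rewrite /coroot linearZl_LR. Qed.

Variable Phi : {fset V}.
Hypotheses (Phi_root : root_system ip Phi) (Phi_cryst : crystallographic ip Phi).

Lemma root_neq0 a : a \in Phi -> a != 0.
Proof. by case: Phi_root => Phi0 _ _; apply: contraTneq => ->. Qed.

Lemma rootN a : a \in Phi -> - a \in Phi.
Proof.
by case: Phi_root => _ PhiR _ Phi_a; have [] := (PhiR a Phi_a (- a)).2 (or_intror erefl).
Qed.

Lemma root_reflection a b : a \in Phi -> b \in Phi -> reflection ip a b \in Phi.
Proof.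
case: Phi_root => _ _ Phi_refl Phi_a Phi_b.
by rewrite -(Phi_refl a Phi_a) in_imfset.
Qed.

(* If the positive integer [<a^vee, b>] is 1, then [s_a b = b - a]; otherwise it
   is at least 2, that is, [<a, a> <= <a, b>]. *)
Lemma root_sub_or a b : a \in Phi -> b \in Phi -> 0 < ip a b ->
  b - a \in Phi \/ ip a a <= ip a b.
Proof.
move=> Phi_a Phi_b ab_gt0.
have aa_gt0 : 0 < ip a a by rewrite neq0_dnorm_gt0 ?root_neq0.
have := Phi_cryst Phi_a Phi_b; have := root_reflection Phi_a Phi_b.
rewrite /reflection ip_coroot => refl_in int_ab.
have : 0 < 2 / ip a a * ip a b by rewrite !mulr_gt0 ?invr_gt0.
case/intrP: int_ab refl_in => m m_def; rewrite m_def ltr0z.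
case: m m_def => // -[|[|m]] // m_def refl_in _.
  by left; rewrite scale1r in refl_in.
right; have : 2 <= 2 / ip a a * ip a b by rewrite m_def ler_nat.
by rewrite -mulrA -[leLHS]mulr1 ler_pM2l // mulrC ler_pdivlMr // mul1r.
Qed.

(** By symmetry [root_sub_or] applies both ways. If neither gives [b - a] up to sign, both [ip a a]
    and [ip b b] are at most [ip a b], so [a - b] has norm at most 0, against [a != b]. *)
Lemma root_sub a b :
  a \in Phi -> b \in Phi -> a != b -> 0 < ip a b -> b - a \in Phi.
Proof.
move=> Phi_a Phi_b neq_ab ab_gt0.
have [//|aa_le] := root_sub_or Phi_a Phi_b ab_gt0.
rewrite ipC in ab_gt0; have [/rootN|bb_le] := root_sub_or Phi_b Phi_a ab_gt0.
  by rewrite opprB.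
case/eqP: neq_ab; apply/subr0_eq/ip_le0.
rewrite linearBl /= !linearBr /= opprB -(addr0 0).
by rewrite lerD // subr_le0.
Qed.

Lemma root_add a b :
  a \in Phi -> b \in Phi -> a + b != 0 -> ip a b < 0 -> a + b \in Phi.
Proof.
move=> Phi_a Phi_b ab_neq0 ab_lt0; rewrite -[in X in _ + X](opprK b).
apply: root_sub => //; first exact: rootN.
- by apply: contraNneq ab_neq0 => <-; rewrite addNr.
by rewrite ipC linearNr oppr_gt0.
Qed.

(* Families with repetitions are needed: a sum of two members may be a third. *)
Definition no_vanishing_subfamily s : Prop :=
  forall u r, perm_eq (u ++ r) s -> u != [::] -> \sum_(x <- u) x != 0.

(** If [x + z] is in [u], splitting it into [x] and [z] keeps the sum of [u]. If it is in the rest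
    [r], splitting it there leaves [u] unchanged. *)
Lemma no_vanishing_subfamily_add x z t :
  no_vanishing_subfamily [:: x, z & t] -> no_vanishing_subfamily (x + z :: t).
Proof.
move=> nvs u r ur_perm u_neq0.
have : x + z \in u ++ r by rewrite (perm_mem ur_perm) mem_head.
rewrite mem_cat => /orP[] xz_in.
  have u_perm := perm_to_rem xz_in.
  have /= := nvs [:: x, z & rem (x + z) u] r.
  rewrite !big_cons addrA (perm_big _ u_perm) big_cons; apply=> //.
  rewrite !perm_cons; rewrite -(perm_cons (x + z)) -cat_cons.
  by rewrite -(permPr ur_perm) perm_cat2r perm_sym.
have r_perm := perm_to_rem xz_in.
apply: (nvs u [:: x, z & rem (x + z) r]) => //.
have /= -> := perm_catCA u [:: x; z] (rem (x + z) r).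
rewrite !perm_cons -(perm_cons (x + z)).
have /= <- := perm_catCA u [:: x + z] (rem (x + z) r).
by rewrite -(permPr ur_perm) perm_cat2l perm_sym.
Qed.

(** Protecting the head [x] makes the induction work: the merged root [x + z] becomes the new head,
    so the member removed always comes from the original family. *)
Lemma removable_root x t : t != [::] -> {subset x :: t <= Phi} ->
    no_vanishing_subfamily (x :: t) -> \sum_(y <- x :: t) y \in Phi ->
  exists2 z, z \in t & \sum_(y <- x :: t) y - z \in Phi.
Proof.
elim: {t}(size t) {-2}t x (leqnn (size t)) => [[]|n IHn t x] // le_t t_neq0 tPhi nvs.
set b := \sum_(y <- x :: t) y => Phi_b.
have Phi_x : x \in Phi by rewrite tPhi ?mem_head.
have Phi_t z : z \in t -> z \in Phi by move=> tz; rewrite tPhi ?inE ?tz ?orbT.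
have bE z : z \in t -> b = x + z + \sum_(y <- rem z t) y.
  by move=> tz; rewrite /b big_cons (perm_big _ (perm_to_rem tz)) big_cons addrA.
have perm_t z : z \in t -> perm_eq [:: x, z & rem z t] (x :: t).
  by move=> tz; rewrite perm_cons perm_sym perm_to_rem.
have [/hasP[z tz bz_gt0]|/hasPn bt_le0] := boolP (has (fun z => 0 < ip z b) t).
  have sum_rem : \sum_(y <- x :: rem z t) y = b - z.
    by rewrite (bE z tz) big_cons addrAC addrK.
  exists z => //; apply: root_sub => //; first exact: Phi_t.
  (* If [z] were [b], the members other than [z] would sum to 0. *)
  rewrite eq_sym -subr_eq0 -sum_rem; apply: (nvs _ [:: z]) => //.
  by rewrite -(permPr (perm_t z tz)) /= perm_cons perm_catC.
have [/hasP[z tz xz_lt0]|/hasPn xt_ge0] := boolP (has (fun z => ip x z < 0) t).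
  have xz_neq0 : x + z != 0.
    have := nvs [:: x; z] (rem z t).
    by rewrite big_cons big_seq1; apply=> //; apply: perm_t.
  have Phi_xz := root_add Phi_x (Phi_t z tz) xz_neq0 xz_lt0.
  (* The induction needs a nonempty tail; without one, [b = x + z] and [b - z] is the root [x]. *)
  have [rem0|rem_neq0] := eqVneq (rem z t) [::].
    by exists z; rewrite // (bE z tz) rem0 big_nil addr0 addrK.
  have [|||||w w_in] := IHn (rem z t) (x + z).
  - by rewrite size_rem // -ltnS prednK // lt0n size_eq0.
  - exact: rem_neq0.
  - by move=> y; rewrite inE => /predU1P[->//|/mem_rem/Phi_t].
  - apply: no_vanishing_subfamily_add => u r; rewrite (permPr (perm_t z tz)).
    exact: nvs.
  - by rewrite big_cons -bE.
  by rewrite big_cons -bE // => Phi_bw; exists w; rewrite ?(mem_rem w_in).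
set c := \sum_(y <- t) y.
have /eqP[] : c != 0.
  by apply: (nvs t [:: x]) => //; rewrite perm_catC.
have b_def : b = x + c by rewrite /b big_cons.
have cE v : ip v c = \sum_(y <- t) ip v y by rewrite linear_sumr.
apply: ip_le0; have -> : ip c c = ip b c - ip x c.
  by rewrite b_def linearDl addrC addKr.
rewrite subr_le0 (@le_trans _ _ 0) // cE big_seq.
  by apply: sumr_le0 => y /bt_le0; rewrite -leNgt ipC.
by apply: sumr_ge0 => y /xt_ge0; rewrite -leNgt.
Qed.

(** This carries [removable_root] over to sets: subfamilies of a duplicate-free enumeration of [X]
    are subsets of [X]. *)
Lemma removable_elem (X : {fset V}) x :
    X `<=` Phi -> summable Phi X -> no_vanishing_subsum X ->
    x \in X -> (1 < #|` X|)%N ->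
  exists y, [/\ y \in X, y != x & summable Phi (X `\ y)].
Proof.
move=> /fsubsetP XPhi X_sum nvs Xx X_gt1.
have X_perm : perm_eq (x :: (X `\ x)) X.
  apply: uniq_perm => [||y]; rewrite /= ?fset_uniq ?andbT ?inE ?eqxx //.
  by have [->|] := eqVneq y x.
have [||||y] := @removable_root x (X `\ x).
- by rewrite -size_eq0 -lt0n; rewrite (cardfsD1 x) Xx in X_gt1.
- by move=> y; rewrite (perm_mem X_perm); apply: XPhi.
- move=> u r; rewrite (permPr X_perm) => ur_perm u_neq0.
  have : uniq (u ++ r) by rewrite (perm_uniq ur_perm) fset_uniq.
  rewrite cat_uniq => /andP[u_uniq _].
  have u_fset : perm_eq [fset y in u] u.
    by apply: uniq_perm => // y; rewrite inE.
  rewrite -(perm_big _ u_fset) /=; apply: nvs.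
    apply/fsubsetP=> y; rewrite inE /= => uy.
    by rewrite -[_ \in X](perm_mem ur_perm) mem_cat uy.
  by rewrite -cardfs_gt0 (perm_size u_fset) lt0n size_eq0.
- by rewrite (perm_big _ X_perm).
rewrite (perm_big _ X_perm) in_fsetD1 => /andP[y_neq Xy] Phi_y.
exists y; split=> //; move: Phi_y.
by rewrite /summable /= (big_fsetD1 y) //= addrC addrK.
Qed.

Lemma no_vanishing_subsumS (X Y : {fset V}) :
  Y `<=` X -> no_vanishing_subsum X -> no_vanishing_subsum Y.
Proof. by move=> YX nvs Z ZY; apply: nvs; apply: fsubset_trans YX. Qed.

(** Members other than [x] are removed one by one until [k] remain. *)
Lemma summable_subset_containing (X : {fset V}) x k :
    X `<=` Phi -> summable Phi X -> no_vanishing_subsum X ->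
    x \in X -> (0 < k <= #|` X|)%N ->
  exists Y : {fset V}, [/\ Y `<=` X, x \in Y, summable Phi Y & #|` Y| = k].
Proof.
move: {2}#|` X| (erefl #|` X|) => n.
elim: n X => [|n IHn] X X_card XPhi X_sum nvs Xx.
  by rewrite X_card leqn0 => /andP[/lt0n_neq0 /negPf->].
case/andP=> k_gt0; rewrite X_card leq_eqVlt => /predU1P[->|]; first by exists X.
rewrite ltnS => k_le.
have X_gt1 : (1 < #|` X|)%N by rewrite X_card ltnS (leq_trans k_gt0).
have [y [Xy y_neq Xy_sum]] := removable_elem XPhi X_sum nvs Xx X_gt1.
have XyX : X `\ y `<=` X := fsubD1set X y.
have Xy_card : #|` X `\ y| = n.
  by move: X_card; rewrite (cardfsD1 y) Xy => -[].
have [||||Y [YX Yx Y_sum Y_card]] := IHn (X `\ y) Xy_card _ Xy_sum.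
- exact: fsubset_trans XPhi.
- exact: no_vanishing_subsumS nvs.
- by rewrite in_fsetD1 eq_sym y_neq.
- by rewrite k_gt0 Xy_card.
by exists Y; split=> //; apply: fsubset_trans XyX.
Qed.

Lemma leq_summable_subsets (X : {fset V}) k :
    X `<=` Phi -> summable Phi X -> no_vanishing_subsum X ->
    (0 < k <= #|` X|)%N ->
  (#|` X| - k < #|` [fset Y in fpowerset X |
                       summable Phi Y & #|` Y| == k]|)%N.
Proof.
move: {2}#|` X| (erefl #|` X|) => n.
elim: n X => [|n IHn] X X_card XPhi X_sum nvs.
  by rewrite X_card leqn0 => /andP[/lt0n_neq0 /negPf->].
case/andP=> k_gt0; rewrite X_card leq_eqVlt => /predU1P[->|].
  rewrite subnn cardfs_gt0; apply/fset0Pn; exists X.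
  by rewrite !inE fpowersetE fsubset_refl X_sum X_card eqxx.
rewrite ltnS => k_le.
have X_gt1 : (1 < #|` X|)%N by rewrite X_card ltnS (leq_trans k_gt0).
have /fset0Pn[x0 Xx0] : X != fset0 by rewrite -cardfs_gt0 ltnW.
have [x [Xx _ Xx_sum]] := removable_elem XPhi X_sum nvs Xx0 X_gt1.
have XxX : X `\ x `<=` X := fsubD1set X x.
have Xx_card : #|` X `\ x| = n.
  by move: X_card; rewrite (cardfsD1 x) Xx => -[].
have [|Y [YX Yx Y_sum Y_card]] := @summable_subset_containing X x k XPhi X_sum nvs Xx.
  by rewrite k_gt0 X_card leqW.
have := IHn (X `\ x) Xx_card (fsubset_trans XxX XPhi) Xx_sum
            (no_vanishing_subsumS XxX nvs).
rewrite k_gt0 Xx_card k_le subSn // => /(_ isT) count_Xx.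
(* The inclusion of the two collections is strict, as [Y] contains [x]. *)
apply: leq_ltn_trans count_Xx _; apply: fproper_ltn_card.
rewrite fproperE; apply/andP; split.
  apply/fsubsetP=> Z; rewrite !inE !fpowersetE => /andP[ZX ->].
  by rewrite (fsubset_trans ZX).
apply/negP=> /fsubsetP/(_ Y); rewrite !inE !fpowersetE fsubsetD1.
by rewrite YX Yx Y_sum Y_card eqxx => /(_ isT).
Qed.

End Roots.

Theorem theorem2p5 (R : realType) (V : vectType R) (ip : {dot V for idfun})
    (Phi : {fset V}) (Phi_root : root_system ip Phi)
    (Phi_cryst : crystallographic ip Phi)
    (X : {fset V}) (X_sub : X `<=` Phi) (X_sum : summable Phi X)
    (X_nvs : no_vanishing_subsum X)
    (p : nat) (p_ge1 : (1 <= p)%N) (p_le : (p <= #|` X|)%N) :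
  (p <= #|` [fset Y in fpowerset X |
               summable Phi Y & #|` Y| == (#|` X| - p + 1)%N]|)%N.
Proof.
have k_le : (0 < #|` X| - p + 1 <= #|` X|)%N.
  by rewrite addn1 /= ltn_subrL p_ge1 (leq_trans p_ge1).
have := leq_summable_subsets Phi_root Phi_cryst X_sub X_sum X_nvs k_le.
(* For [k = #|X| - p + 1] the strict lower bound [#|X| - k] equals [p - 1]. *)
by apply: leq_trans; rewrite addn1 subnS subKn // prednK.
Qed.
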